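(* Let $\tilde g(a_1):=-\frac{2}{27}a_1(4a_1^2+27)$. With the sets $Z_{21},Z_{12},Z_{ij}^{\pm},Z_{ij}^0\subset\mathbb R^2$ defined in the context, one has $$Z_{21}^+=Z_{21}\cap\{a_2>\tilde g(a_1)\},\qquad Z_{12}^+=Z_{12}\cap\{a_2>\tilde g(a_1)\},$$ $$Z_{21}^-=Z_{21}\cap\{a_2<\tilde g(a_1)\},\qquad Z_{12}^-=Z_{12}\cap\{a_2<\tilde g(a_1)\},$$ $$Z_{21}^0=Z_{21}\cap\{a_2=\tilde g(a_1)\}=\{(a_1,a_2): a_2=\tilde g(a_1),\ a_1<0\},$$ $$Z_{12}^0=Z_{12}\cap\{a_2=\tilde g(a_1)\}=\{(a_1,a_2): a_2=\tilde g(a_1),\ a_1>0\}.$$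
   Context: For $(a_1,a_2)\in\mathbb R^2$ let $F(\psi,x)=\frac12a_2x^2+a_1x+b(x)\cos\psi$ on $(\mathbb R/2\pi\mathbb Z)\times(0,1)$, with $b(x)=\sqrt{(1-x)^3x}$. Set $g(a_1):=\frac1{27}(\sqrt{9+4a_1^2}-2a_1)(9-4a_1^2-4a_1\sqrt{9+4a_1^2})$ and $$Z_{12}:=\{(a_1,a_2): -g(-a_1)<a_2<-a_1\},\qquad Z_{21}:=\{(a_1,a_2): -a_1<a_2<g(a_1)\}.$$ For $(a_1,a_2)\in Z_{21}$ the function $x\mapsto F(0,x)$ on $(0,1)$ has exactly two critical points $x_1^{(0)}<x_2^{(0)}$, a local maximum and a local minimum respectively; $(0,x_2^{(0)})$ is a saddle of $F$ and $E_{\rm sad}:=F(0,x_2^{(0)})$. For $(a_1,a_2)\in Z_{12}$ the function $x\mapsto F(\pi,x)$ on $(0,1)$ has exactly two critical points $x_1^{(\pi)}<x_2^{(\pi)}$, a local minimum and a local maximum respectively; $(\pi,x_2^{(\pi)})$ is a saddle of $F$ and $E_{\rm sad}:=F(\pi,x_2^{(\pi)})$. For $(i,j)\in\{(2,1),(1,2)\}$ define $$Z_{ij}^{\pm}:=\{(a_1,a_2)\in Z_{ij}:\ \pm E_{\rm sad}>0\},\qquad Z_{ij}^0:=\{(a_1,a_2)\in Z_{ij}:\ E_{\rm sad}=0\}.$$ *)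

(* Defs.v *)
From HB Require Import structures.
From mathcomp Require Import all_boot all_order all_algebra.
From mathcomp Require Import all_classical all_reals all_analysis.
Import Order.TTheory GRing.Theory Num.Theory.
Import numFieldNormedType.Exports.

Set Implicit Arguments.
Unset Strict Implicit.
Unset Printing Implicit Defensive.

Local Open Scope classical_set_scope.
Local Open Scope ring_scope.

Section Definitions.
Context {R : realType}.
Implicit Types (a : R * R) (f : R -> R) (x E : R).

Definition b x : R := Num.sqrt ((1 - x) ^+ 3 * x).

(* The angle psi is represented by a real number; F is 2 pi-periodic in psi. *)
Definition F a (psi x : R) : R :=
  2^-1 * a.2 * x ^+ 2 + a.1 * x + b x * cos psi.

Definition g (a1 : R) : R :=
  27^-1 * (Num.sqrt (9 + 4 * a1 ^+ 2) - 2 * a1)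
  * (9 - 4 * a1 ^+ 2 - 4 * a1 * Num.sqrt (9 + 4 * a1 ^+ 2)).

Definition gtilde (a1 : R) : R := - (2 / 27) * a1 * (4 * a1 ^+ 2 + 27).

Definition Z12 : set (R * R) := [set a | - g (- a.1) < a.2 < - a.1].

Definition Z21 : set (R * R) := [set a | - a.1 < a.2 < g a.1].

Definition critical_point f x : Prop := is_derive x (1 : R) f 0.

Definition local_max f x : Prop := \forall y \near x, f y <= f x.

Definition local_min f x : Prop := \forall y \near x, f x <= f y.

Definition two_critical_points f x1 x2 : Prop :=
  [/\ 0 < x1, x1 < x2, x2 < 1
    & forall x, 0 < x < 1 -> (critical_point f x <-> x = x1 \/ x = x2)].

(* The saddle energy is given as a relation rather than by a choice function,
   so that no default value occurs: each relation includes the existence of the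
   two critical points and their nature, and determines E uniquely. *)
Definition Esad21 a E : Prop :=
  exists x1 x2, [/\ two_critical_points (F a 0) x1 x2,
    local_max (F a 0) x1, local_min (F a 0) x2 & E = F a 0 x2].

Definition Esad12 a E : Prop :=
  exists x1 x2, [/\ two_critical_points (F a pi) x1 x2,
    local_min (F a pi) x1, local_max (F a pi) x2 & E = F a pi x2].

Definition Z21_pos : set (R * R) :=
  [set a | Z21 a /\ exists E, Esad21 a E /\ 0 < E].
Definition Z21_neg : set (R * R) :=
  [set a | Z21 a /\ exists E, Esad21 a E /\ 0 < - E].
Definition Z21_zero : set (R * R) :=
  [set a | Z21 a /\ exists E, Esad21 a E /\ E = 0].

Definition Z12_pos : set (R * R) :=
  [set a | Z12 a /\ exists E, Esad12 a E /\ 0 < E].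
Definition Z12_neg : set (R * R) :=
  [set a | Z12 a /\ exists E, Esad12 a E /\ 0 < - E].
Definition Z12_zero : set (R * R) :=
  [set a | Z12 a /\ exists E, Esad12 a E /\ E = 0].

End Definitions.

(* Main.v *)
Require Import Defs.
From HB Require Import structures.
From mathcomp Require Import all_boot all_order all_algebra.
From mathcomp Require Import all_classical all_reals all_analysis.
From mathcomp Require Import ring lra.
Import Order.TTheory GRing.Theory Num.Theory.
Import numFieldNormedType.Exports.
Local Open Scope classical_set_scope.
Local Open Scope ring_scope.

(* Put s = sqrt ((1 - x) / x), a decreasing bijection from (0, 1) to (0, oo), so
   that x = 1 / (1 + s^2).  The x-derivative of F(0, .) is then (x / 2) q(s) with
   q(s) = s^3 + 2 a_1 s^2 - 3 s + 2 (a_1 + a_2).  On Z21 one has q(0) > 0, and q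
   is negative at its positive critical point, so q has roots
   s3 < 0 < s2 < s1 and the saddle x_2 corresponds to s2.  Eliminating a_2 with
   q(s2) = 0 gives E_sad = (x_2 / 4) (3 s2 + 2 a_1), which compares s2 with the
   mean s0 = - 2 a_1 / 3 of the roots; and q(s0) = 2 (a_2 - gtilde a_1).  Since
   s3 < s0 < s1, the signs of q(s0) and of s2 - s0 agree.  The statements for Z12
   follow from F(pi, x; a) = - F(0, x; - a). *)

(** * Local extrema from the sign of the derivative, and their behaviour under negation *)

Lemma local_max_derive_sign (R : realType) (f df : R -> R) (l x u : R) :
  l < x -> x < u ->
  (forall y, l < y < u -> is_derive y 1 f (df y)) ->
  (forall y, l < y < x -> 0 <= df y) ->
  (forall y, x < y < u -> df y <= 0) -> local_max f x.
Proof.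
move=> lx xu fdf df_ge0 df_le0.
have fc (y z : R) : l < y -> z < u -> {within `[y, z], continuous f}.
  move=> ly zu; apply: continuous_in_subspaceT => t; rewrite inE/= in_itv/=.
  move=> /andP[yt tz]; apply: differentiable_continuous; apply/derivable1_diffP.
  have /fdf[] : l < t < u by rewrite (lt_le_trans ly yt) (le_lt_trans tz zu).
  by [].
have : \forall y \near x, y \in `]l, u[.
  by apply: near_in_itvoo; rewrite in_itv/= lx xu.
apply: filterS => y; rewrite in_itv/= => /andP[ly yu].
have [yx|xy|->//] := ltgtP y x.
(* By the mean value theorem, the increment of [f] between [y] and [x] is their distance times
   [df c] for some [c] between them, where the sign of [df] is known. *)
- have [|c cyx fxy] := @MVT _ f df y x yx _ (fc _ _ ly xu).
    by move=> t; rewrite in_itv/= => ?; apply: fdf; lra.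
  move: cyx; rewrite in_itv/= -subr_ge0 fxy => /andP[yc cx].
  by apply: mulr_ge0; [apply: df_ge0; lra | lra].
- have [|c cxy fxy] := @MVT _ f df x y xy _ (fc _ _ lx yu).
    by move=> t; rewrite in_itv/= => ?; apply: fdf; lra.
  move: cxy; rewrite in_itv/= -subr_le0 fxy => /andP[xc cy].
  by apply: mulr_le0_ge0; [apply: df_le0; lra | lra].
Qed.

Lemma local_minN (R : realType) (f : R -> R) (x : R) :
  local_min f x <-> local_max (fun y => - f y) x.
Proof.
by split; apply: filterS => y; rewrite lerN2.
Qed.

Lemma local_maxN (R : realType) (f : R -> R) (x : R) :
  local_max f x <-> local_min (fun y => - f y) x.
Proof.
by split; apply: filterS => y; rewrite lerN2.
Qed.

(** * The substitution s = sqrt ((1 - x) / x) and the derivative of F(0, .) *)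

Definition slope {R : realType} (x : R) : R := Num.sqrt ((1 - x) / x).

Definition cubic {R : realType} (a : R * R) (s : R) : R :=
  s ^+ 3 + 2 * a.1 * s ^+ 2 - 3 * s + 2 * (a.1 + a.2).

Lemma slope_gt0 (R : realType) (x : R) : 0 < x < 1 -> 0 < slope x.
Proof. by move=> /andP[x0 x1]; rewrite sqrtr_gt0 divr_gt0// subr_gt0. Qed.

Lemma slopeK (R : realType) (x : R) : 0 < x < 1 ->
  (1 + slope x ^+ 2)^-1 = x.
Proof.
move=> /andP[x0 x1]; rewrite sqr_sqrtr; last by rewrite divr_ge0// ?subr_ge0 ltW.
by field; rewrite gt_eqF//=; lra.
Qed.

Lemma invD1sqr_itv (R : realType) (s : R) : 0 < s ->
  0 < (1 + s ^+ 2)^-1 < 1.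
Proof.
move=> s0; have s20 : 0 < s ^+ 2 by rewrite exprn_gt0.
by apply/andP; split; [rewrite invr_gt0 | rewrite invf_lt1]; lra.
Qed.

Lemma slope_invD1sqr (R : realType) (s : R) : 0 < s ->
  slope (1 + s ^+ 2)^-1 = s.
Proof.
move=> s0; have s20 : 0 < s ^+ 2 by rewrite exprn_gt0.
rewrite /slope (_ : _ / _ = s ^+ 2) ?sqrtr_sqr ?gtr0_norm//.
by field; rewrite ?lt0r_neq0//; lra.
Qed.

Lemma slope_lt (R : realType) (x y : R) : 0 < x -> x < y -> y < 1 ->
  slope y < slope x.
Proof.
move=> x0 xy y1; rewrite ltr_sqrt; last by rewrite divr_gt0//; lra.
rewrite ltr_pdivrMr ?(lt_trans x0)// mulrAC ltr_pdivlMr//.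
by rewrite -subr_gt0 (_ : _ - _ = y - x) ?subr_gt0//; ring.
Qed.

Lemma b_slope (R : realType) (x : R) : 0 < x < 1 ->
  b x = x * (1 - x) * slope x.
Proof.
move=> x01; have s0 := slope_gt0 _ _ x01.
rewrite /b -[LHS]/(Num.sqrt _) (_ : (1 - x) ^+ 3 * x = (x * (1 - x) * slope x) ^+ 2).
  by rewrite sqrtr_sqr ger0_norm// !mulr_ge0//; lra.
rewrite exprMn sqr_sqrtr; last by rewrite divr_ge0//; lra.
by field; lra.
Qed.

Lemma is_derive_b (R : realType) (x : R) : 0 < x < 1 ->
  is_derive x 1 (@b R) ((1 - 4 * x) * slope x / 2).
Proof.
move=> x01; have s0 := slope_gt0 _ _ x01.
have p0 : 0 < (1 - x) ^+ 3 * x by rewrite mulr_gt0 ?exprn_gt0//; lra.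
have hs := is_derive1_sqrt p0.
have hp : is_derive x 1 (fun y : R => (1 - y) ^+ 3 * y)
    ((1 - x) ^+ 2 * (1 - 4 * x)).
  apply: is_derive_eq; rewrite /GRing.scale/=; ring.
have hc := @is_derive1_comp _ _ (fun y : R => (1 - y) ^+ 3 * y) _ _ _ hs hp.
apply: (is_derive_eq hc).
rewrite -[Num.sqrt _]/(b x) b_slope//.
have sE : slope x ^+ 2 = (1 - x) / x by rewrite sqr_sqrtr// divr_ge0//; lra.
(* Multiplying by [slope x] cancels it on the left and leaves only its square on the right, so the
   identity becomes rational in [x]. *)
apply: (@mulfI _ (slope x)); first by rewrite gt_eqF.
rewrite [RHS](_ : _ = (1 - 4 * x) * slope x ^+ 2 / 2); last by ring.
by rewrite sE; field; rewrite !lt0r_neq0//; lra.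
Qed.

Lemma is_derive_F0 (R : realType) (a : R * R) (x : R) : 0 < x < 1 ->
  is_derive x 1 (F a 0) (x / 2 * cubic a (slope x)).
Proof.
move=> x01; have hb := is_derive_b _ _ x01.
rewrite (_ : F a 0 = fun y => 2^-1 * a.2 * y ^+ 2 + a.1 * y + b y); last first.
  by apply/funext => y; rewrite /F cos0 mulr1.
apply: is_derive_eq; rewrite /GRing.scale/= /cubic.
have s0 := slope_gt0 _ _ x01.
(* Writing x as 1 / (1 + s^2) turns the goal into an identity of rational functions of s. *)
have := slopeK _ _ x01; move: (slope x) s0 => s s0 <-.
by field; apply: lt0r_neq0; rewrite ltr_wpDr ?sqr_ge0.
Qed.

Lemma F0_slope (R : realType) (a : R * R) (x : R) : 0 < x < 1 ->
  cubic a (slope x) = 0 -> F a 0 x = x / 4 * (3 * slope x + 2 * a.1).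
Proof.
move=> x01; rewrite /F cos0 mulr1 b_slope//.
have s0 := slope_gt0 _ _ x01.
have := slopeK _ _ x01; move: (slope x) s0 => s s0 <-.
rewrite /cubic => qs0.
have a2E : a.2 = - (s ^+ 3 + 2 * a.1 * s ^+ 2 - 3 * s + 2 * a.1) / 2 by lra.
by rewrite a2E; field; apply: lt0r_neq0; rewrite ltr_wpDr ?sqr_ge0.
Qed.

(* [(r - 2 a_1) / 3] is the positive zero of the derivative of the cubic. *)
Lemma cubic_critical (R : realType) (a : R * R) :
  let r := Num.sqrt (9 + 4 * a.1 ^+ 2) in
  cubic a ((r - 2 * a.1) / 3) = 2 * (a.2 - g a.1).
Proof.
move=> r; have r2 : r ^+ 2 = 9 + 4 * a.1 ^+ 2.
  by rewrite sqr_sqrtr// addr_ge0// mulr_ge0// sqr_ge0.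
rewrite /cubic /g -/r; move: r r2 => r r2; apply/eqP; rewrite -subr_eq0; apply/eqP.
rewrite [LHS](_ : _ = (r ^+ 2 - 9 - 4 * a.1 ^+ 2) * (r - 8 * a.1) / 27); last by field.
by rewrite r2; ring.
Qed.

(** By [cubic_critical], 2 (a_2 - g a_1) is the value of the cubic at its local minimum, while 2
    (a_2 - gtilde a_1) is its value at the inflection point - 2 a_1 / 3. The two points are r / 3
    apart, with r the square root, and a monic cubic drops by 2 d^3 over such a distance d. *)
Lemma g_gtilde (R : realType) (a1 : R) :
  g a1 = gtilde a1 + Num.sqrt (9 + 4 * a1 ^+ 2) ^+ 3 / 27.
Proof.
rewrite /g /gtilde; set r := Num.sqrt _.
have r2 : r ^+ 2 = 9 + 4 * a1 ^+ 2.
  by rewrite sqr_sqrtr// addr_ge0// mulr_ge0// sqr_ge0.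
apply/eqP; rewrite -subr_eq0; apply/eqP.
rewrite [LHS](_ : _ = (9 + 4 * a1 ^+ 2 - r ^+ 2) * (r + 4 * a1) / 27); last by field.
by rewrite r2; ring.
Qed.

(** * Roots of the cubic on Z21 *)

Lemma cubic_ivt (R : realType) (a : R * R) (u v : R) : u < v ->
  (cubic a u < 0 < cubic a v) || (cubic a v < 0 < cubic a u) ->
  exists2 s, u < s < v & cubic a s = 0.
Proof.
move=> uv sgn.
pose p : {poly R} :=
  'X^3 + (2 * a.1)%:P * 'X^2 - 3%:P * 'X + (2 * (a.1 + a.2))%:P.
have pE s : p.[s] = cubic a s by rewrite /p /cubic !hornerE.
have [s sab ps] : exists2 s, u <= s <= v & cubic a s = 0.
  have [/andP[qu qv]|/andP[qv qu]] := orP sgn.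
    have [|s sab] := @poly_ivt _ p u v (ltW uv).
      by rewrite !pE !ltW.
    by move=> /rootP; rewrite pE; exists s.
  have [|s sab] := @poly_ivt _ (- p) u v (ltW uv).
    by rewrite !hornerN !pE oppr_le0 oppr_ge0 !ltW.
  by rewrite rootN => /rootP; rewrite pE; exists s.
exists s => //; move: sab; rewrite !le_eqVlt => /andP[/predU1P[us|->]].
  by move: sgn; rewrite us ps ltxx andbF.
by move=> /predU1P[sv|//]; move: sgn; rewrite -sv ps ltxx andbF.
Qed.

(** The intermediate value theorem yields only [s2] and [s1], on either side of the critical point.
    The third root is defined through the sum of the roots, and the other two Vieta relations are
    then deduced from [s1] and [s2] being distinct roots. *)
Lemma cubic_factor (R : realType) (a : R * R) : Z21 a ->
  exists s1 s2 s3, [/\ s3 < 0, 0 < s2, s2 < s1, s1 + s2 + s3 = - 2 * a.1 &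
    forall s, cubic a s = (s - s1) * (s - s2) * (s - s3)].
Proof.
move=> /andP[a12 a2g]; have := cubic_critical _ a => /=.
set r := Num.sqrt _ => qm.
have r2 : r ^+ 2 = 9 + 4 * a.1 ^+ 2.
  by rewrite sqr_sqrtr// addr_ge0// mulr_ge0// sqr_ge0.
have r0 : 0 < r by rewrite sqrtr_gt0 ltr_pwDl// mulr_ge0// sqr_ge0.
have m0 : 0 < (r - 2 * a.1) / 3.
  apply: divr_gt0 => //; rewrite subr_gt0 -[ltRHS]gtr0_norm//.
  rewrite (le_lt_trans (ler_norm _))// -ltr_sqr ?nnegrE//.
  by rewrite !real_normK ?num_real// r2; lra.
move: ((r - 2 * a.1) / 3) m0 qm => m m0 qm.
(* The bound a_2 < g a_1 makes the cubic negative at its critical point, and - a_1 < a_2 makes it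
   positive at 0. *)
have qm0 : cubic a m < 0 by lra.
have q00 : 0 < cubic a 0 by rewrite /cubic; lra.
(* [M] exceeds [m] and makes both M and M + 2 a_1 at least 3, so that M^2 (M + 2 a_1) dominates 3
   M. *)
pose M := m + 2 * `|a.1| + 3.
have qM0 : 0 < cubic a M.
  have n0 := normr_ge0 a.1; have n1 := ler_norm (- a.1); rewrite normrN in n1.
  have M3 : 3 <= M by rewrite /M; lra.
  have M2a : 3 <= M + 2 * a.1 by rewrite /M; lra.
  by rewrite /cubic; nra.
have mM : m < M by rewrite /M; have := normr_ge0 a.1; lra.
have [|s2 /andP[s20 s2m] qs2] := cubic_ivt _ a _ _ m0.
  by rewrite qm0 q00 orbT.
have [|s1 /andP[s1m _] qs1] := cubic_ivt _ a _ _ mM.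
  by rewrite qm0 qM0.
have s21 : s2 < s1 by exact: lt_trans s1m.
pose s3 := - 2 * a.1 - s1 - s2.
(* Subtract the two root equations and divide by s1 - s2. *)
have e2 : s1 * s2 + s3 * (s1 + s2) = - 3.
  apply: (@mulfI _ (s1 - s2)); first by rewrite subr_eq0 gt_eqF.
  apply/eqP; rewrite -subr_eq0; apply/eqP.
  transitivity (cubic a s2 - cubic a s1); last by rewrite qs1 qs2 subrr.
  by rewrite /s3 /cubic; ring.
have e3 : - (s1 * s2 * s3) = 2 * (a.1 + a.2).
  move: qs2; rewrite /cubic (_ : a.1 = - (s1 + s2 + s3) / 2).
    by move=> qs2; nra.
  by rewrite /s3; field.
exists s1, s2, s3; split => //.
(* By [e3], - s1 s2 s3 = 2 (a_1 + a_2), which is positive on Z21. *)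
- have : 0 < s1 * s2 * - s3 by lra.
  by rewrite pmulr_rgt0 ?oppr_gt0// mulr_gt0//; lra.
- by rewrite /s3; ring.
- move=> s; rewrite /cubic -e3.
  rewrite -[3]opprK -e2 (_ : 2 * a.1 = - (s1 + s2 + s3)); first by ring.
  by rewrite /s3; ring.
Qed.

(** * The saddle energy on Z21: existence, sign and uniqueness *)

Lemma Esad21_exists (R : realType) (a : R * R) : Z21 a ->
  exists2 E, Esad21 a E & Num.sg E = Num.sg (a.2 - gtilde a.1).
Proof.
move=> /cubic_factor[s1 [s2 [s3 [s30 s20 s21 ss qE]]]].
have s10 : 0 < s1 by exact: lt_trans s21.
(* The substitution reverses order, so the larger root gives the left critical point. *)
pose x1 := (1 + s1 ^+ 2)^-1; pose x2 := (1 + s2 ^+ 2)^-1.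
have /andP[x10 x11] : 0 < x1 < 1 := invD1sqr_itv _ _ s10.
have /andP[x20 x21] : 0 < x2 < 1 := invD1sqr_itv _ _ s20.
have sx1 : slope x1 = s1 by exact: slope_invD1sqr.
have sx2 : slope x2 = s2 by exact: slope_invD1sqr.
have x12 : x1 < x2.
  have [] : 0 < s1 ^+ 2 /\ 0 < s2 ^+ 2 by split; exact: exprn_gt0.
  have : s2 ^+ 2 < s1 ^+ 2 by rewrite ltrXn2r ?nnegrE ?ltW.
  by move=> *; rewrite ltf_pV2 ?posrE; lra.
have F2 : F a 0 x2 = x2 / 4 * (3 * s2 + 2 * a.1).
  by rewrite F0_slope ?x20 ?x21// sx2// qE subrr mulr0 mul0r.
exists (F a 0 x2).
  exists x1, x2; split; last by [].
  - split; [by []..|move=> x x01].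
    have s0 := slope_gt0 _ _ x01; have [x0 _] := andP x01.
    have F' := is_derive_F0 _ a _ x01.
    split => [[_ F0]|].
      (* Uniqueness of the derivative makes [slope x] a root, and positivity of [slope x] excludes
         [s3]. *)
      have /eqP : x / 2 * cubic a (slope x) = 0.
        by rewrite -F0; have [_ ->] := F'.
      rewrite mulf_eq0 qE !mulf_eq0 !subr_eq0 => /orP[|]; first by lra.
      rewrite -orbA => /or3P[/eqP xs|/eqP xs|/eqP]; last lra.
        by left; rewrite -(slopeK _ _ x01) xs.
      by right; rewrite -(slopeK _ _ x01) xs.
    by move=> xE; apply: (is_derive_eq F'); case: xE => ->;
      rewrite qE ?sx1 ?sx2 subrr ?mulr0 !(mul0r, mulr0).
  (* Left of [x1] all three factors of the cubic are positive; between [x1] and [x2] only the factor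
     of [s1] is negative. *)
  - apply: (@local_max_derive_sign _ _
      (fun y => y / 2 * cubic a (slope y)) 0 _ x2 x10 x12) => y.
    + by move=> yI; apply: is_derive_F0; lra.
    + move=> /andP[y0 y1]; rewrite qE.
      have : s1 < slope y by rewrite -sx1; apply: slope_lt; lra.
      move=> sy; apply: mulr_ge0; first lra.
      by do 2!(apply: mulr_ge0; last lra); lra.
    + move=> /andP[y1 y2]; rewrite qE.
      have sy1 : slope y < s1 by rewrite -sx1; apply: slope_lt; lra.
      have sy2 : s2 < slope y by rewrite -sx2; apply: slope_lt; lra.
      apply: mulr_ge0_le0; first lra.
      by do 2!(apply: mulr_le0_ge0; last lra); lra.
  - apply/local_minN.
    (* Right of [x2] the factors of [s1] and [s2] are both negative, so F(0, .) increases again. *)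
    apply: (@local_max_derive_sign _ _
      (fun y => - (y / 2 * cubic a (slope y))) x1 _ 1 x12 x21) => y.
    + move=> yI; have yI' : 0 < y < 1 by lra.
      by have := is_derive_F0 _ a _ yI'; exact: is_deriveN.
    + move=> /andP[y1 y2]; rewrite qE oppr_ge0.
      have sy1 : slope y < s1 by rewrite -sx1; apply: slope_lt; lra.
      have sy2 : s2 < slope y by rewrite -sx2; apply: slope_lt; lra.
      apply: mulr_ge0_le0; first lra.
      by do 2!(apply: mulr_le0_ge0; last lra); lra.
    + move=> /andP[y2 y1]; rewrite qE oppr_le0.
      have y0 : 0 < y by lra.
      have s0 : 0 < slope y by apply: slope_gt0; lra.
      have : slope y < s2 by rewrite -sx2; apply: slope_lt; lra.
      move=> sy; apply: mulr_ge0; first lra.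
      by apply: mulr_ge0; [apply: mulr_le0|]; lra.
have q0 : cubic a (- 2 * a.1 / 3) = 2 * (a.2 - gtilde a.1).
  by rewrite /cubic /gtilde; field.
(* The mean of the roots lies strictly between the least and the greatest; hence the energy and a_2
   - gtilde a_1 are both positive multiples of [s2] minus this mean. *)
have c0 : 0 < (s1 - - 2 * a.1 / 3) * (- 2 * a.1 / 3 - s3).
  by apply: mulr_gt0; lra.
have sg_pmul k w : 0 < k -> Num.sg (k * w) = Num.sg w :> R.
  by move=> k0; rewrite sgrM gtr0_sg// mul1r.
have -> : F a 0 x2 = 3 * x2 / 4 * (s2 - - 2 * a.1 / 3) by rewrite F2; field.
have -> : a.2 - gtilde a.1 = (s1 - - 2 * a.1 / 3) * (- 2 * a.1 / 3 - s3) / 2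
    * (s2 - - 2 * a.1 / 3).
  by apply: (@mulfI _ 2); [lra | rewrite -q0 qE; field].
by rewrite !sg_pmul; lra.
Qed.

(** Both ordered pairs enumerate the same set of critical points in (0, 1), so their larger members
    coincide. *)
Lemma Esad21_uniq (R : realType) (a : R * R) (E E' : R) :
  Esad21 a E -> Esad21 a E' -> E = E'.
Proof.
move=> [x1 [x2 [[x10 x12 x21 fx] _ _ ->]]] [y1 [y2 [[y10 y12 y21 fy] _ _ ->]]].
have Cx x : 0 < x < 1 -> (x = x1 \/ x = x2) <-> (x = y1 \/ x = y2).
  by move=> x01; exact: iff_trans (iff_sym (fx x x01)) (fy x x01).
have x1I : 0 < x1 < 1 by lra.
have x2I : 0 < x2 < 1 by lra.
have y1I : 0 < y1 < 1 by lra.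
have y2I : 0 < y2 < 1 by lra.
have := (Cx _ x1I).1 (or_introl erefl); have := (Cx _ x2I).1 (or_intror erefl).
have := (Cx _ y2I).2 (or_intror erefl).
suff : x2 = y2 -> F a 0 x2 = F a 0 y2 by move=> h *; apply: h; lra.
by move=> ->.
Qed.

Lemma sg_Esad21 (R : realType) (a : R * R) (E : R) : Z21 a -> Esad21 a E ->
  Num.sg E = Num.sg (a.2 - gtilde a.1).
Proof.
move=> za aE; have [E' aE' <-] := Esad21_exists _ _ za.
by rewrite (Esad21_uniq _ _ _ _ aE aE').
Qed.

(** * Passage from Z21 to Z12 by a change of sign, and the curve a_2 = gtilde a_1 *)

Lemma F_pi (R : realType) (a : R * R) (x : R) :
  F a pi x = - F (- a.1, - a.2) 0 x.
Proof. by rewrite /F cospi cos0/=; ring. Qed.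

Lemma Z12_opp (R : realType) (a : R * R) : Z12 a <-> Z21 (- a.1, - a.2).
Proof. by rewrite /Z12 /Z21/= opprK ltrNl ltrNr andbC. Qed.

Lemma gtilde_opp (R : realType) (a1 : R) : gtilde (- a1) = - gtilde a1.
Proof. by rewrite /gtilde; ring. Qed.

Lemma critical_pointN (R : realType) (f : R -> R) (x : R) :
  critical_point (fun y => - f y) x <-> critical_point f x.
Proof.
split=> fx; have := @is_deriveN _ _ _ _ _ _ _ fx; rewrite oppr0//.
by congr (is_derive _ _ _ _); apply/funext => y /=; rewrite /GRing.opp/= opprK.
Qed.

(** Negating a function keeps its critical points and exchanges local maxima with local minima. *)
Lemma Esad12_opp (R : realType) (a : R * R) (E : R) :
  Esad12 a E <-> Esad21 (- a.1, - a.2) (- E).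
Proof.
rewrite /Esad21; have -> : F (- a.1, - a.2) 0 = fun x => - F a pi x.
  by apply/funext => x; rewrite F_pi opprK.
split=> -[x1 [x2 [[x10 x12 x21 fx] m1 m2 EF]]]; exists x1, x2; split.
- split; [by []..|move=> x x01]; rewrite critical_pointN; exact: fx.
- exact/local_minN.
- exact/local_maxN.
- by rewrite EF.
- split; [by []..|move=> x x01]; rewrite -critical_pointN; exact: fx.
- exact/local_minN.
- exact/local_maxN.
- exact: oppr_inj.
Qed.

(** On the curve the upper bound is automatic by [g_gtilde], and the lower bound reads 0 < (1 + 8
    a_1^2 / 27) (- a_1). *)
Lemma Z21_gtilde (R : realType) (a : R * R) :
  a.2 = gtilde a.1 -> Z21 a <-> a.1 < 0.
Proof.
move=> aE; rewrite /Z21/= aE g_gtilde.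
have -> : gtilde a.1 < gtilde a.1 + Num.sqrt (9 + 4 * a.1 ^+ 2) ^+ 3 / 27.
  by rewrite ltrDl divr_gt0// exprn_gt0// sqrtr_gt0 ltr_pwDl// mulr_ge0// sqr_ge0.
rewrite andbT -subr_gt0.
rewrite (_ : _ - _ = (1 + 8 / 27 * a.1 ^+ 2) * (- a.1)); last first.
  by rewrite /gtilde; field.
by rewrite pmulr_rgt0 ?oppr_gt0// ltr_pwDl// mulr_ge0 ?sqr_ge0//; lra.
Qed.

Lemma Z12_gtilde (R : realType) (a : R * R) :
  a.2 = gtilde a.1 -> Z12 a <-> 0 < a.1.
Proof.
move=> aE; rewrite Z12_opp Z21_gtilde/= ?oppr_lt0//.
by rewrite gtilde_opp aE.
Qed.

(** * The sign of the saddle energy on Z12, and the set equalities *)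

Lemma sg_Esad12 (R : realType) (a : R * R) (E : R) : Z12 a -> Esad12 a E ->
  Num.sg E = Num.sg (a.2 - gtilde a.1).
Proof.
move=> /Z12_opp za /Esad12_opp/(sg_Esad21 _ _ _ za)/=.
by rewrite gtilde_opp -opprD !sgrN => /oppr_inj.
Qed.

Lemma Esad12_exists (R : realType) (a : R * R) : Z12 a -> exists E, Esad12 a E.
Proof.
move=> /Z12_opp/Esad21_exists[E aE _]; exists (- E).
by apply/Esad12_opp; rewrite opprK.
Qed.

(** Converts an equality of signs into the three cases at once; it serves with [P] a saddle relation
    and [v] = a_2 - gtilde a_1. The existence of a value is what gives the right-to-left
    directions. *)
Lemma exists_sg_trichotomy (R : realType) (P : R -> Prop) (v : R) :
  (exists E, P E) -> (forall E, P E -> Num.sg E = Num.sg v) ->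
  [/\ (exists E, P E /\ 0 < E) <-> 0 < v,
      (exists E, P E /\ 0 < - E) <-> v < 0 &
      (exists E, P E /\ E = 0) <-> v = 0].
Proof.
move=> [E0 PE0] Psg; split; split => [[E [/Psg sE]]|v_sgn].
- by rewrite -sgr_gt0 sE sgr_gt0.
- by exists E0; rewrite -sgr_gt0 Psg// sgr_gt0.
- by rewrite oppr_gt0 -sgr_lt0 sE sgr_lt0.
- by exists E0; rewrite oppr_gt0 -sgr_lt0 Psg// sgr_lt0.
- by move=> /eqP; rewrite -sgr_eq0 sE sgr_eq0 => /eqP.
- by exists E0; split=> //; apply/eqP; rewrite -sgr_eq0 Psg// sgr_eq0 v_sgn.
Qed.

Theorem lemma5 (R : realType) :
  (@Z21_pos R = Z21 `&` [set a : R * R | gtilde a.1 < a.2]) /\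
  (@Z12_pos R = Z12 `&` [set a : R * R | gtilde a.1 < a.2]) /\
  (@Z21_neg R = Z21 `&` [set a : R * R | a.2 < gtilde a.1]) /\
  (@Z12_neg R = Z12 `&` [set a : R * R | a.2 < gtilde a.1]) /\
  (@Z21_zero R = Z21 `&` [set a : R * R | a.2 = gtilde a.1] /\
   Z21 `&` [set a : R * R | a.2 = gtilde a.1]
     = [set a : R * R | a.2 = gtilde a.1 /\ a.1 < 0]) /\
  (@Z12_zero R = Z12 `&` [set a : R * R | a.2 = gtilde a.1] /\
   Z12 `&` [set a : R * R | a.2 = gtilde a.1]
     = [set a : R * R | a.2 = gtilde a.1 /\ 0 < a.1]).
Proof.
have H21 (a : R * R) : Z21 a ->
    [/\ (exists E, Esad21 a E /\ 0 < E) <-> gtilde a.1 < a.2,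
        (exists E, Esad21 a E /\ 0 < - E) <-> a.2 < gtilde a.1 &
        (exists E, Esad21 a E /\ E = 0) <-> a.2 = gtilde a.1].
  move=> za; have [E0 aE0 _] := Esad21_exists _ _ za.
  have [|E /(sg_Esad21 _ _ _ za)//|] := exists_sg_trichotomy _ (Esad21 a)
    (a.2 - gtilde a.1); first by exists E0.
  by rewrite subr_gt0 subr_lt0 (rwP eqP) subr_eq0 -(rwP eqP).
have H12 (a : R * R) : Z12 a ->
    [/\ (exists E, Esad12 a E /\ 0 < E) <-> gtilde a.1 < a.2,
        (exists E, Esad12 a E /\ 0 < - E) <-> a.2 < gtilde a.1 &
        (exists E, Esad12 a E /\ E = 0) <-> a.2 = gtilde a.1].
  move=> za.
  have [|E /(sg_Esad12 _ _ _ za)//|] := exists_sg_trichotomy _ (Esad12 a)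
    (a.2 - gtilde a.1); first exact: Esad12_exists.
  by rewrite subr_gt0 subr_lt0 (rwP eqP) subr_eq0 -(rwP eqP).
do !split; apply/seteqP; split=> a /=.
(* The inclusions about the signed parts follow propositionally from [H21] and [H12]; the four that
   remain locate the curve by the sign of a_1. *)
all: try by move=> [za h]; split=> //; have [p n z] := H21 _ za; tauto.
all: try by move=> [za h]; split=> //; have [p n z] := H12 _ za; tauto.
- by move=> [za aE]; split=> //; apply/(Z21_gtilde _ _ aE).
- by move=> [aE a0]; split=> //; apply/(Z21_gtilde _ _ aE).
- by move=> [za aE]; split=> //; apply/(Z12_gtilde _ _ aE).
- by move=> [aE a0]; split=> //; apply/(Z12_gtilde _ _ aE).
Qed.
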